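(* Let $\alpha=(\alpha_1,\dots,\alpha_r)$ be a multi-index with entries in $\{1,\dots,m\}$ and let $\vec l=(l_1,\dots,l_p)$ with $1\le l_1<\cdots<l_p=r$, $p\le r$. Let $V^i_j:\mathbb{R}^d\to\mathbb{R}$, $1\le i\le d$, $1\le j\le m$, be of class $C^{r-p}$, and let $f^i_j\in C^{r-p}(\mathbb{R}^d)$ for $i=1,\dots,p$, $j=1,\dots,m$. Then $$\mathcal V_{\alpha_{0,l_1}}\Big(f^1_{\alpha_{l_1}}\cdots\mathcal V_{\alpha_{l_{p-2},l_{p-1}}}\big(f^{p-1}_{\alpha_{l_{p-1}}}\mathcal V_{\alpha_{l_{p-1},l_p}}f^p_{\alpha_{l_p}}\big)\Big)=\sum_{1\le\tau_1<\cdots<\tau_p=r}\ \sum_{\rho\in\Xi_r(\vec l;\vec\tau)}\big(\mathcal V_{(\alpha\circ\rho)_{0,\tau_1}}f^1_{(\alpha\circ\rho)_{\tau_1}}\big)\cdots\big(\mathcal V_{(\alpha\circ\rho)_{\tau_{p-1},\tau_p}}f^p_{(\alpha\circ\rho)_{\tau_p}}\big),$$ where $\vec\tau=(\tau_1,\dots,\tau_p)$ and sums over empty sets are zero.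
   Context: $\mathcal V_jf=\sum_{i=1}^dV^i_j\partial_if$, $j=1,\dots,m$, and $\mathcal V_{j_1,\dots,j_k}=\mathcal V_{j_1}\cdots\mathcal V_{j_k}$ (the identity operator for the empty multi-index). For a multi-index $\alpha$ and $i<j$, $\alpha_{i,j}=(\alpha_{i+1},\dots,\alpha_{j-1})$. For a permutation $\rho$ of $\{1,\dots,r\}$, $\alpha\circ\rho=(\alpha_{\rho(1)},\dots,\alpha_{\rho(r)})$. The left-hand side is the nested expression in which, for $i=1,\dots,p-1$, the operator $\mathcal V_{\alpha_{l_{i-1},l_i}}$ ($l_0=0$) is applied to the product of $f^i_{\alpha_{l_i}}$ with the next nested expression, the innermost one being $\mathcal V_{\alpha_{l_{p-1},l_p}}f^p_{\alpha_{l_p}}$. With $\tau_0=0$, $\Xi_r(\vec l;\vec\tau)$ is the set of permutations $\rho$ of $\{1,\dots,r\}$ such that $\rho(\tau_i)<\rho(\tau_j)$ for $i<j$, $\rho$ is increasing on each block $\{\tau_{i-1}+1,\dots,\tau_i\}$, and $\rho(\tau_i)=l_i$ for $i=1,\dots,p$. *)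

(* Defs.v *)
From mathcomp Require Import all_boot all_order all_algebra all_fingroup.
From mathcomp Require Import all_classical all_reals all_analysis.

Set Implicit Arguments.
Unset Strict Implicit.
Unset Printing Implicit Defensive.

Import Order.TTheory GRing.Theory Num.Theory.
Import numFieldNormedType.Exports.

Local Open Scope ring_scope.

Section Analysis.
Variables (R : realType) (d m : nat).

Definition partial (i : 'I_d) (f : 'rV[R]_d -> R) : 'rV[R]_d -> R :=
  fun x => 'D_(delta_mx 0 i) f x.

(* C^k on R^d: all iterated partial derivatives of order at most k exist
   everywhere and are continuous. *)
Fixpoint classC (k : nat) (f : 'rV[R]_d -> R) : Prop :=
  continuous f /\
  if k is k'.+1 then
    forall i : 'I_d,
      (forall x, derivable f x (delta_mx 0 i)) /\ classC k' (partial i f)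
  else True.

(* [V i j] is the i-th coordinate of the j-th vector field. *)
Variable V : 'I_d -> 'I_m -> 'rV[R]_d -> R.

Definition vfield (j : 'I_m) (f : 'rV[R]_d -> R) : 'rV[R]_d -> R :=
  fun x => \sum_(i < d) V i j x * partial i f x.

(* [:: j1; ...; jk] acts as V_j1 (V_j2 (... (V_jk f))). *)
Definition vfields (s : seq 'I_m) (f : 'rV[R]_d -> R) : 'rV[R]_d -> R :=
  foldr vfield f s.

End Analysis.

(* Positions in {1, ..., r} are encoded by 'I_r: the element k stands for the
   1-based position k.+1.  A multi-index of length r is a map 'I_r -> 'I_m, so
   that alpha o rho is a composition, and a vector (l_1, ..., l_p) of positions
   is a p.-tuple whose (i.+1)-st component is [tnth l i]. *)
Section Combinatorics.
Variables (r p : nat).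

(* The 1-based value l_i for 1 <= i <= p, with l_0 = 0. *)
Definition pos (l : p.-tuple 'I_r) (i : nat) : nat :=
  nth 0%N (0%N :: [seq (nat_of_ord k).+1 | k <- l]) i.

(* 1 <= l_1 < ... < l_p = r *)
Definition increasing_to_end (l : p.-tuple 'I_r) : bool :=
  [forall i : 'I_p, pos l i < pos l i.+1]%N && (pos l p == r).

(* alpha_{a,b} = (alpha_{a+1}, ..., alpha_{b-1}), with 1-based positions *)
Definition between (T : Type) (alpha : 'I_r -> T) (a b : nat) : seq T :=
  [seq alpha k | k : 'I_r <- enum 'I_r & (a < k.+1 < b)%N].

Definition Xi (l tau : p.-tuple 'I_r) : {set 'S_r} :=
  [set rho : 'S_r |
    [&& [forall i : 'I_p, forall j : 'I_p,
           (i < j)%N ==> (rho (tnth tau i) < rho (tnth tau j))%N],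
        [forall i : 'I_p, forall k1 : 'I_r, forall k2 : 'I_r,
           [&& (pos tau i < k1.+1)%N, (k1 < k2)%N & (k2.+1 <= pos tau i.+1)%N]
             ==> (rho k1 < rho k2)%N]
      & [forall i : 'I_p, rho (tnth tau i) == tnth l i]]].

End Combinatorics.

Section Nested.
Variables (R : realType) (d m r p : nat).
Variables (V : 'I_d -> 'I_m -> 'rV[R]_d -> R).
Variables (f : 'I_p -> 'I_m -> 'rV[R]_d -> R).
Variables (alpha : 'I_r -> 'I_m) (l : p.-tuple 'I_r).

(* The value on the empty list is never used when p > 0: the innermost level
   is the one-element list. *)
Fixpoint nested_rec (s : seq 'I_p) : 'rV[R]_d -> R :=
  match s with
  | [::] => fun=> 1
  | i :: s' =>
      let fi := f i (alpha (tnth l i)) in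
      vfields V (between alpha (pos l i) (pos l i.+1))
        (if s' is [::] then fi else fun x => fi x * nested_rec s' x)
  end.

Definition nested : 'rV[R]_d -> R := nested_rec (enum 'I_p).

End Nested.

(* Main.v *)
Require Import Defs.
From mathcomp Require Import all_boot all_order all_algebra all_fingroup.
From mathcomp Require Import all_classical all_reals all_analysis.

Set Implicit Arguments.
Unset Strict Implicit.
Unset Printing Implicit Defensive.

Import Order.TTheory GRing.Theory Num.Theory.
Import numFieldNormedType.Exports.

Local Open Scope ring_scope.

(** A letter of [alpha] at a position outside [l] is a derivation that acts on
    everything to its right, that is on the product of the factors [f i] whose
    own position [tnth l i] comes later.  By the Leibniz rule the nested
    expression is therefore a sum over all ways of sending each such derivation
    to one later factor.  A choice is recorded as a map [c] from positions to
    factors, where the position of a factor is sent to that factor; these are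
    the members of [family (allowed l)], and the summand of [c] is the product
    over [i] of the derivatives [c^-1(i)], in their original order, applied to
    [f i].  This is [nested_positions] followed by [expand_positions]; the
    Leibniz rule for finite products is [vfield_prod], and the smoothness
    hypotheses enter because, as long as a derivation remains to be applied,
    each factor of a summand has received fewer than [r - p] of them
    ([size_word_lt]).

    It remains to see that such maps [c] are the pairs [(tau, rho)] of the
    right-hand side.  List the positions of [c^-1(0)] increasingly, then those
    of [c^-1(1)], and so on: this listing is [rho], and [tau] tells where each
    block ends.  Since nothing in [c^-1(i)] lies beyond [tnth l i], the block
    [i] ends with [tnth l i], as [Xi] requires of a listing that increases on
    each block.  Conversely
    [c] sends a position to the block of the listing that contains it.  That
    these two constructions are inverse to each other is [big_listing]. *)

(** * Smooth functions and the Leibniz rule *)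

Section Smoothness.
Variables (R : realType) (d m : nat).
Implicit Types (f g : 'rV[R]_d -> R).

Lemma classC_leq k n f : (k <= n)%N -> classC n f -> classC k f.
Proof.
elim: n k f => [|n IHn] [|k] f //=; first by move=> _ [].
by move=> le_kn [cf df]; split=> // i; have [di /IHn ci] := df i; split; auto.
Qed.

Lemma classC_derivable k f (i : 'I_d) x :
  (0 < k)%N -> classC k f -> derivable f x (delta_mx 0 i).
Proof. by case: k => // k _ [_ /(_ i) []]. Qed.

Lemma partialD (i : 'I_d) f g :
    (forall x, derivable f x (delta_mx 0 i)) ->
    (forall x, derivable g x (delta_mx 0 i)) ->
  partial i (fun x => f x + g x) = (fun x => partial i f x + partial i g x).
Proof. by move=> df dg; apply/funext => x; rewrite /partial deriveD. Qed.

Lemma partialM (i : 'I_d) f g :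
    (forall x, derivable f x (delta_mx 0 i)) ->
    (forall x, derivable g x (delta_mx 0 i)) ->
  partial i (fun x => f x * g x) =
  (fun x => f x * partial i g x + g x * partial i f x).
Proof. by move=> df dg; apply/funext => x; rewrite /partial deriveM. Qed.

Lemma classC_cst k (a : R) : classC k (fun _ : 'rV[R]_d => a).
Proof.
elim: k a => [|k IHk] a /=; split=> //; try exact: cst_continuous.
move=> i; split=> [x|]; first exact: derivable_cst.
suff -> : partial i (fun=> a) = fun=> 0 by [].
by apply/funext => x; rewrite /partial derive_cst.
Qed.

Lemma classCD k f g :
  classC k f -> classC k g -> classC k (fun x => f x + g x).
Proof.
elim: k f g => [|k IHk] f g /= [cf df] [cg dg]; split=> //;
  try by move=> x; apply: continuousD; [apply: cf | apply: cg].
move=> i; have [[dif cif] [dig cig]] := (df i, dg i).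
by split=> [x|]; [apply: derivableD | rewrite partialD //; apply: IHk].
Qed.

Lemma classCM k f g :
  classC k f -> classC k g -> classC k (fun x => f x * g x).
Proof.
elim: k f g => [|k IHk] f g Cf Cg; have [/= cf df] := Cf; have [/= cg dg] := Cg;
  split=> //; try by move=> x; apply: continuousM; [apply: cf | apply: cg].
move=> i; have [[dif cif] [dig cig]] := (df i, dg i).
split=> [x|]; first exact: derivableM.
rewrite partialM //; apply: classCD; apply: IHk => //.
  exact: classC_leq Cf.
exact: classC_leq Cg.
Qed.

Lemma classC_sum k (I : Type) (s : seq I) (F : I -> 'rV[R]_d -> R) :
  (forall i, classC k (F i)) -> classC k (fun x => \sum_(i <- s) F i x).
Proof.
move=> CF; elim: s => [|i s IHs].
  by under eq_fun do rewrite big_nil; apply: classC_cst.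
by under eq_fun do rewrite big_cons; apply: classCD.
Qed.

Variable V : 'I_d -> 'I_m -> 'rV[R]_d -> R.

Lemma classC_vfield k j f :
    (forall i, classC k (V i j)) -> classC k.+1 f -> classC k (vfield V j f).
Proof.
move=> CV [_ Cf]; apply: classC_sum => i.
by apply: classCM => //; have [] := Cf i.
Qed.

Lemma classC_vfields n k (s : seq 'I_m) f :
    (forall i j, classC n (V i j)) -> classC n f -> (k + size s <= n)%N ->
  classC k (vfields V s f).
Proof.
move=> CV Cf; elim: s k => [|j s IHs] k /=.
  by rewrite addn0 => /classC_leq; apply.
rewrite addnS => le_n; apply: classC_vfield; last by apply: IHs.
move=> i; apply: classC_leq (CV i j).
exact: leq_trans (leq_addr _ _) (ltnW le_n).
Qed.

(** Differentiability along the coordinate axes is all that the Leibniz rule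
    for [vfield] uses. *)
Definition has_partials f := forall i x, derivable f x (delta_mx 0 i).

Lemma has_partials_sum (I : Type) (s : seq I) (P : pred I)
    (F : I -> 'rV[R]_d -> R) :
    (forall i, P i -> has_partials (F i)) ->
  has_partials (fun x => \sum_(i <- s | P i) F i x).
Proof.
move=> dF; elim: s => [|i s IHs] j x.
  by under eq_fun do rewrite big_nil; apply: derivable_cst.
under eq_fun do rewrite big_cons; case: ifP => Pi; last exact: IHs.
by apply: derivableD; [apply: dF | apply: IHs].
Qed.

Lemma has_partials_prod (I : Type) (s : seq I) (P : pred I)
    (F : I -> 'rV[R]_d -> R) :
    (forall i, P i -> has_partials (F i)) ->
  has_partials (fun x => \prod_(i <- s | P i) F i x).
Proof.
move=> dF; elim: s => [|i s IHs] j x.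
  by under eq_fun do rewrite big_nil; apply: derivable_cst.
under eq_fun do rewrite big_cons; case: ifP => Pi; last exact: IHs.
by apply: derivableM; [apply: dF | apply: IHs].
Qed.

Lemma vfield_cst j (a : R) : vfield V j (fun=> a) = (fun=> 0).
Proof.
by apply/funext => x; apply: big1 => i _; rewrite /partial derive_cst mulr0.
Qed.

Lemma vfieldD j f g : has_partials f -> has_partials g ->
  vfield V j (fun x => f x + g x) = (fun x => vfield V j f x + vfield V j g x).
Proof.
move=> df dg; apply/funext => x; rewrite /vfield -big_split.
by apply: eq_bigr => i _; rewrite partialD // mulrDr.
Qed.

Lemma vfieldM j f g : has_partials f -> has_partials g ->
  vfield V j (fun x => f x * g x) =
  (fun x => f x * vfield V j g x + g x * vfield V j f x).
Proof.
move=> df dg; apply/funext => x; rewrite /vfield !mulr_sumr -big_split.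
apply: eq_bigr => i _; rewrite partialM //= mulrDr.
by rewrite mulrCA (mulrCA (V i j x) (g x)).
Qed.

Lemma vfield_sum j (I : Type) (s : seq I) (P : pred I)
    (F : I -> 'rV[R]_d -> R) :
    (forall i, P i -> has_partials (F i)) ->
  vfield V j (fun x => \sum_(i <- s | P i) F i x) =
  (fun x => \sum_(i <- s | P i) vfield V j (F i) x).
Proof.
move=> dF; elim: s => [|i s IHs]; apply/funext => x.
  by under eq_fun do rewrite big_nil; rewrite vfield_cst big_nil.
under eq_fun do rewrite big_cons; rewrite big_cons.
case: ifP => Pi; last by rewrite IHs.
by rewrite vfieldD ?IHs //; [apply: dF | apply: has_partials_sum].
Qed.

(** The Leibniz rule, with the derived factor marked inside the product rather
    than pulled out of it, so that each summand is again a product of the same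
    shape. *)
Lemma vfield_prod j (I : finType) (P : pred I) (F : I -> 'rV[R]_d -> R) :
    (forall i, P i -> has_partials (F i)) ->
  vfield V j (fun x => \prod_(i | P i) F i x) =
  (fun x => \sum_(a | P a)
     \prod_(i | P i) (if i == a then vfield V j (F i) else F i) x).
Proof.
(* The induction needs an index list whose entries are distinct: the head
   must differ from every factor of the tail. *)
have [s [us Es]] : exists s : seq I, uniq s /\ s = index_enum I.
  by exists (index_enum I); rewrite index_enum_uniq.
rewrite -Es => dF; elim: s us {Es} => [|b s IHs] /=.
  move=> _; apply/funext => x.
  by under eq_fun do rewrite big_nil; rewrite vfield_cst big_nil.
move=> /andP[b_s us]; have {}IHs := IHs us; apply/funext => x.
have neq_b i : i \in s -> (i == b) = false.
  by move=> i_s; apply: contraNF b_s => /eqP <-.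
under eq_fun do rewrite big_cons; rewrite big_cons.
case: ifP => Pb; last first.
  rewrite IHs; apply: eq_bigr => a _.
  by rewrite big_cons Pb.
rewrite vfieldM ?IHs; [|exact: dF|exact: has_partials_prod].
rewrite big_cons Pb eqxx [LHS]addrC; congr (_ + _).
  rewrite mulrC; congr (_ * _); rewrite big_seq_cond [RHS]big_seq_cond.
  by apply: eq_bigr => i /andP[i_s _]; rewrite neq_b.
rewrite mulr_sumr big_seq_cond [RHS]big_seq_cond; apply: eq_bigr => a /andP[a_s _].
by rewrite big_cons Pb eq_sym neq_b.
Qed.

End Smoothness.

(** * Increasing tuples of positions *)

Section Positions.
Variables r p : nat.
Implicit Types l tau : p.-tuple 'I_r.

Lemma posS l (i : 'I_p) : pos l i.+1 = (tnth l i).+1.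
Proof. by rewrite /pos /= (nth_map (tnth l i)) ?size_tuple // -tnth_nth. Qed.

Lemma increasing_pos l : increasing_to_end l -> pos l p = r.
Proof. by case/andP=> _ /eqP. Qed.

Lemma increasing_pos_mono l (a b : nat) :
  increasing_to_end l -> (a <= b <= p)%N -> (pos l a <= pos l b)%N.
Proof.
case/andP=> /forallP incr_l _ /andP[].
elim: b => [|b IHb]; first by rewrite leqn0 => /eqP->.
rewrite leq_eqVlt => /orP[/eqP-> //|le_ab] lt_bp.
by apply: leq_trans (IHb le_ab (ltnW lt_bp)) (ltnW (incr_l (Ordinal lt_bp))).
Qed.

Lemma increasing_tnth l (i j : 'I_p) :
  increasing_to_end l -> (i < j)%N -> (tnth l i < tnth l j)%N.
Proof.
move=> incr_l lt_ij; have /andP[/forallP/(_ j) lt_j _] := incr_l.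
rewrite -ltnS -!posS; apply: leq_ltn_trans lt_j.
by apply: increasing_pos_mono; rewrite // lt_ij ltnW.
Qed.

Lemma increasing_tnth_leq l (i j : 'I_p) :
  increasing_to_end l -> (tnth l i <= tnth l j)%N = (i <= j)%N.
Proof.
move=> incr_l; case: (leqP i j) => [|lt_ji].
  rewrite leq_eqVlt => /orP[/eqP/val_inj->|lt_ij]; first exact: leqnn.
  by rewrite ltnW // increasing_tnth.
by apply/negbTE; rewrite -ltnNge increasing_tnth.
Qed.

Lemma increasing_tnth_inj l : increasing_to_end l -> injective (tnth l).
Proof.
move=> incr_l i j eq_ij; apply/val_inj/eqP.
by rewrite eqn_leq -!(increasing_tnth_leq _ _ incr_l) eq_ij leqnn.
Qed.

(** The start of block [i] is described by the ends of all earlier blocks, and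
    not only of the previous one, so that the first block, which starts at the
    conventional value [pos l 0], needs no special case. *)
Lemma pos_leq l (i : 'I_p) (q : nat) : increasing_to_end l ->
  (pos l i <= q)%N = [forall j : 'I_p, (j < i)%N ==> (tnth l j < q)%N].
Proof.
move=> incr_l; apply/idP/forallP => [le_q j | lt_q].
  apply/implyP => lt_ji; apply: leq_trans le_q; rewrite -posS.
  by apply: increasing_pos_mono; rewrite // lt_ji ltnW.
case: i lt_q => [[|i] lt_ip] //= lt_q.
rewrite (posS l (Ordinal (ltnW lt_ip))).
by have /implyP := lt_q (Ordinal (ltnW lt_ip)); apply.
Qed.

Lemma increasingI l :
    (forall i j : 'I_p, (i < j)%N -> (tnth l i < tnth l j)%N) ->
    pos l p = r ->
  increasing_to_end l.
Proof.
move=> lt_l pos_p; apply/andP; split; last exact/eqP.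
apply/forallP => -[[|i] lt_ip]; first by rewrite (posS l (Ordinal lt_ip)).
rewrite (posS l (Ordinal lt_ip)) (posS l (Ordinal (ltnW lt_ip))) ltnS.
exact: lt_l.
Qed.

End Positions.

Section OrdLists.
Variable r : nat.

Lemma enum_ord_sorted : sorted (fun i j : 'I_r => (i < j)%N) (enum 'I_r).
Proof.
by have := iota_ltn_sorted 0 r; rewrite -val_enum_ord sorted_map.
Qed.

Lemma ord_sorted_eq (s t : seq 'I_r) :
    sorted (fun i j : 'I_r => (i < j)%N) s ->
    sorted (fun i j : 'I_r => (i < j)%N) t ->
  s =i t -> s = t.
Proof. by apply: irr_sorted_eq => [j i k|i]; [apply: ltn_trans | apply: ltnn]. Qed.

Lemma filter_enum_ord_sorted (P : pred 'I_r) :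
  sorted (fun i j : 'I_r => (i < j)%N) [seq k : 'I_r <- enum 'I_r | P k].
Proof.
by apply: sorted_filter enum_ord_sorted => j i k; apply: ltn_trans.
Qed.

Lemma mem_filter_enum (P : pred 'I_r) k :
  (k \in [seq q <- enum 'I_r | P q]) = P k.
Proof. by rewrite mem_filter mem_enum andbT. Qed.

Definition positions_from (n : nat) : seq 'I_r :=
  [seq k : 'I_r <- enum 'I_r | (n <= k)%N].

Lemma mem_positions n (k : 'I_r) : (k \in positions_from n) = (n <= k)%N.
Proof. exact: mem_filter_enum. Qed.

Lemma positions_from_uniq n : uniq (positions_from n).
Proof. exact: filter_uniq (enum_uniq _). Qed.

Lemma positions_from0 : positions_from 0 = enum 'I_r.
Proof. by apply/all_filterP/allP. Qed.

Lemma positions_from_geq n : (r <= n)%N -> positions_from n = [::].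
Proof.
move=> le_rn; apply/eqP; rewrite -(negbK (_ == _)) -has_filter.
by apply/hasPn => k _; rewrite -ltnNge (leq_trans (ltn_ord k)).
Qed.

Lemma positions_from_split n (k : 'I_r) : (n <= k)%N ->
  positions_from n =
  [seq q : 'I_r <- enum 'I_r | (n < q.+1 < k.+1)%N] ++ k :: positions_from k.+1.
Proof.
move=> le_nk; apply: ord_sorted_eq; first exact: filter_enum_ord_sorted.
  have tr : transitive (fun i j : 'I_r => (i < j)%N).
    by move=> ? ? ?; apply: ltn_trans.
  rewrite sorted_pairwise // pairwise_cat pairwise_cons -!sorted_pairwise //.
  rewrite !filter_enum_ord_sorted andbT; apply/and3P; split=> //.
    apply/allrelP => i j; rewrite mem_filter_enum inE mem_positions !ltnS.
    move=> /andP[_ lt_i].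
    by case/orP=> [/eqP-> //|]; apply: ltn_trans lt_i.
  by apply/allP => q; rewrite mem_positions.
move=> q; rewrite mem_cat inE !mem_positions mem_filter_enum !ltnS.
rewrite -(inj_eq val_inj) /=.
case: (ltngtP q k) => [_|lt_kq|->]; rewrite ?andbT ?andbF ?orbF //=.
by rewrite (leq_trans le_nk) // ltnW.
Qed.

Lemma positions_from_cons (k : 'I_r) :
  positions_from k = k :: positions_from k.+1.
Proof.
rewrite {1}(positions_from_split (leqnn k)) (_ : [seq _ <- _ | _] = [::]) //.
apply/eqP; rewrite -(negbK (_ == _)) -has_filter.
by apply/hasPn => q _; rewrite !ltnS; case: ltngtP.
Qed.

End OrdLists.

(** * The Leibniz expansion of the nested expression *)

Section FamilySum.
Variables (S : nmodType) (A B : finType).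

Definition update (c : {ffun A -> B}) (k : A) (j : B) : {ffun A -> B} :=
  [ffun q => if q == k then j else c q].

(** To choose a function of [family F] is to choose it away from [k], keeping
    the dummy value [y] at [k], and then to choose its value at [k]. *)
Lemma big_family_update (F F' : A -> pred B) (k : A) (y : B)
    (G : {ffun A -> B} -> S) :
    F' k =1 pred1 y -> (forall q, q != k -> F' q =1 F q) ->
  \sum_(c in family F) G c =
  \sum_(c in family F') \sum_(j | F k j) G (update c k j).
Proof.
move=> F'k F'q; rewrite pair_big_dep /=.
rewrite (reindex_onto (fun cj => update cj.1 k cj.2)
                      (fun c => (update c k y, c k))) /=.
  apply: eq_bigl => -[c j] /=; rewrite xpair_eqE andbC; apply/andP/andP => -[].
    rewrite ffunE eqxx => /andP[/eqP/ffunP Ec _] /familyP Fc; split.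
      apply/familyP => q; have [->|ne_qk] := eqVneq q k.
        by have:= Ec k; rewrite !ffunE eqxx => <-; rewrite unfold_in F'k /=.
      by have:= Fc q; rewrite ffunE (negbTE ne_qk) !unfold_in F'q.
    by have:= Fc k; rewrite ffunE eqxx.
  move=> /familyP Fc Fj; rewrite ffunE !eqxx andbT; split; last first.
    apply/familyP => q; rewrite ffunE; case: eqP => [->|/eqP ne_qk] //.
    by have:= Fc q; rewrite !unfold_in F'q.
  apply/eqP/ffunP => q; rewrite !ffunE.
  by case: eqP => // ->; have:= Fc k; rewrite unfold_in F'k => /eqP.
move=> c _; apply/ffunP => q; rewrite !ffunE.
by case: eqP => // ->.
Qed.

End FamilySum.

Section Expansion.
Variables (R : realType) (d m r p : nat).
Variables (V : 'I_d -> 'I_m -> 'rV[R]_d -> R).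
Variables (f : 'I_p -> 'I_m -> 'rV[R]_d -> R).
Variables (alpha : 'I_r -> 'I_m) (l : p.-tuple 'I_r).
Hypothesis l_incr : increasing_to_end l.

(** The nested expression read one position at a time: the position of a factor
    multiplies by it, any other position differentiates all that follows.  The
    innermost factor is multiplied by the constant 1. *)
Definition nested_from (s : seq 'I_r) : 'rV[R]_d -> R :=
  foldr (fun k g => if [pick i | tnth l i == k] is Some i
                    then fun x => f i (alpha k) x * g x
                    else vfield V (alpha k) g)
        (fun=> 1) s.

Variant mark_spec (k : 'I_r) : option 'I_p -> bool -> Type :=
  | Marked i of tnth l i = k : mark_spec k (Some i) true
  | Unmarked of (forall i, k != tnth l i) : mark_spec k None false.

Lemma markP k : mark_spec k [pick i | tnth l i == k] (k \in l).
Proof.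
case: pickP => [i /eqP Ek|ne_k].
  by rewrite (_ : (k \in l) = true); [constructor | rewrite -Ek mem_tnth].
rewrite (_ : (k \in l) = false).
  by constructor=> i; rewrite eq_sym ne_k.
by apply/tnthP => -[i Ek]; have:= ne_k i; rewrite Ek eqxx.
Qed.

Lemma nested_from_unmarked (u s : seq 'I_r) : {in u, forall k, k \notin l} ->
  nested_from (u ++ s) = vfields V (map alpha u) (nested_from s).
Proof.
elim: u => //= k u IHu u_l; rewrite IHu => [|q u_q];
  last by rewrite u_l ?inE ?u_q ?orbT.
by have:= u_l k (mem_head _ _); case: markP.
Qed.

Lemma nested_from_marked i s :
  nested_from (tnth l i :: s) =
  fun x => f i (alpha (tnth l i)) x * nested_from s x.
Proof.
by rewrite /=; case: markP => [j /(increasing_tnth_inj l_incr)->|/(_ i)/eqP].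
Qed.

Lemma nested_positions : nested V f alpha l = nested_from (enum 'I_r).
Proof.
suff H n i : (i + n)%N = p ->
    nested_rec V f alpha l (drop i (enum 'I_p)) =
    nested_from (positions_from r (pos l i)).
  by rewrite /nested -{1}(drop0 (enum 'I_p)) (H p) // positions_from0.
elim: n i => [|n IHn] i.
  rewrite addn0 => ->; rewrite increasing_pos // positions_from_geq //.
  rewrite drop_oversize //.
  by rewrite size_enum_ord.
rewrite addnS -addSn => Ep; have lt_ip : (i < p)%N by rewrite -Ep leq_addr.
rewrite (drop_nth (Ordinal lt_ip)) ?size_enum_ord //.
rewrite (nth_ord_enum (Ordinal lt_ip) (Ordinal lt_ip)).
have /andP[/forallP/(_ (Ordinal lt_ip)) + _] := l_incr.
rewrite [pos l (Ordinal lt_ip).+1]posS ltnS => le_pos.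
rewrite (positions_from_split le_pos) nested_from_unmarked => [|k]; last first.
  rewrite mem_filter_enum !ltnS => /andP[ge_k lt_k].
  case: markP => // j Ek; move: ge_k lt_k; rewrite -Ek pos_leq //
    => /forallP/(_ j).
  by rewrite ltnn implybF -leqNgt ltnNge increasing_tnth_leq // => ->.
rewrite -posS nested_from_marked -IHn //= /between.
case: drop => [|j s] //=; congr vfields.
by apply/funext => x; rewrite mulr1.
Qed.

(** The factors on which the letter at position [k] can act; the position of a
    factor is bound to that factor. *)
Definition allowed (k : 'I_r) : pred 'I_p :=
  fun j => if k \in l then tnth l j == k else (k <= tnth l j)%N.

Lemma allowed_leq k j : allowed k j -> (k <= tnth l j)%N.
Proof. by rewrite /allowed; case: ifP => // _ /eqP->. Qed.

(** The derivations that hit the factor [j] once the positions from [n] on have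
    been read; [tnth l j] is left out because it carries the factor itself. *)
Definition word (c : 'I_r -> 'I_p) (n : nat) (j : 'I_p) : seq 'I_m :=
  [seq alpha k | k <- positions_from r n & (c k == j) && (k != tnth l j)].

Definition term (c : 'I_r -> 'I_p) (n : nat) : 'rV[R]_d -> R := fun x =>
  \prod_(j < p | (n <= tnth l j)%N)
     vfields V (word c n j) (f j (alpha (tnth l j))) x.

(** Choices for the positions from [n] on only: earlier positions get the dummy
    value [y], so that each partial choice is counted once. *)
Definition allowed_from (y : 'I_p) (n : nat) (k : 'I_r) : pred 'I_p :=
  if (n <= k)%N then allowed k else pred1 y.

Lemma word_update (c : {ffun 'I_r -> 'I_p}) (k : 'I_r) (a j : 'I_p) :
  word (update c k a) k j =
  (if (a == j) && (k != tnth l j) then [:: alpha k] else [::]) ++ word c k.+1 j.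
Proof.
have E :
  [seq q <- positions_from r k.+1 | (update c k a q == j) && (q != tnth l j)] =
  [seq q <- positions_from r k.+1 | (c q == j) && (q != tnth l j)].
  apply: eq_in_filter => q; rewrite mem_positions ffunE.
  by case: (q =P k) => // ->; rewrite ltnn.
rewrite /word positions_from_cons /= ffunE eqxx E.
by case: ifP.
Qed.

(** A word consists of distinct positions outside [l], of which there are
    [r - p]; the position [k], still to be read, is one of these and not in the
    word.  So one more derivative of the factor exists. *)
Lemma size_word_lt (y : 'I_p) (c : {ffun 'I_r -> 'I_p}) (k : 'I_r) (j : 'I_p) :
    c \in family (allowed_from y k.+1) -> k \notin l ->
  (size (word c k.+1 j) < r - p)%N.
Proof.
move=> /familyP c_fam l'k; rewrite size_map.
set w := [seq _ <- _ | _]; have w_uniq : uniq (k :: w).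
  rewrite /= filter_uniq ?positions_from_uniq //.
  by rewrite mem_filter mem_positions ltnn andbF.
have -> : (r - p)%N = #|[predC l]|.
  have l_uniq : uniq l by apply/tuple_uniqP/increasing_tnth_inj.
  by rewrite -[r in LHS]card_ord -(cardC (mem l)) (card_uniqP l_uniq) size_tuple addKn.
rewrite -[(size w).+1]/(size (k :: w)) -(card_uniqP w_uniq).
apply/subset_leq_card/fintype.subsetP => q; rewrite inE => /orP[/eqP->|] //.
rewrite mem_filter mem_positions => /andP[/andP[/eqP Ej ne_q] lt_q].
have:= c_fam q; rewrite /allowed_from lt_q !inE Ej unfold_in /allowed.
by case: ifP => // _ /eqP Eq; rewrite Eq eqxx in ne_q.
Qed.

Hypothesis V_C : forall i j, classC (r - p) (V i j).
Hypothesis f_C : forall i j, classC (r - p) (f i j).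

(** The Leibniz expansion, by reading the positions from right to left: a factor
    multiplies each term, a derivation splits each term according to the factor
    it hits. *)
Lemma expand_positions (y : 'I_p) n : (n <= r)%N ->
  nested_from (positions_from r n) =
  fun x => \sum_(c in family (allowed_from y n)) term c n x.
Proof.
move=> le_nr; have [k] := ubnP (r - n); elim: k n le_nr => // k IHk n.
rewrite leq_eqVlt => /orP[/eqP-> _|lt_nr lt_k].
  rewrite positions_from_geq //; apply/funext => x /=.
  rewrite (big_pred1 [ffun=> y]) => [|c].
    by rewrite /term big_pred0 // => j; rewrite leqNgt ltn_ord.
  apply/familyP/eqP => [c_fam|-> q]; last first.
    by rewrite ffunE /allowed_from leqNgt ltn_ord unfold_in /=.
  apply/ffunP => q; rewrite ffunE; have:= c_fam q.
  by rewrite /allowed_from leqNgt ltn_ord unfold_in => /eqP.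
have {}IHk : nested_from (positions_from r n.+1) =
    fun x => \sum_(c in family (allowed_from y n.+1)) term c n.+1 x.
  by apply: IHk => //; rewrite subnS prednK ?subn_gt0 // -ltnS.
pose q := Ordinal lt_nr.
have En G : \sum_(c in family (allowed_from y n)) G c =
    \sum_(c in family (allowed_from y n.+1))
      \sum_(j | allowed q j) G (update c q j) :> R.
  rewrite (@big_family_update _ _ _ _ (allowed_from y n.+1) q y)
    => [|j|t ne_tq].
  - apply: eq_bigr => c _; apply: eq_bigl => j.
    by rewrite /allowed_from leqnn.
  - by rewrite /allowed_from ltnn.
  rewrite /allowed_from ltn_neqAle -[n]/(val q) (inj_eq val_inj).
  by rewrite eq_sym ne_tq.
apply/funext => x; rewrite {}En -[n]/(val q) positions_from_cons.
case: (boolP (q \in l)) => [/tnthP[i Eq]|l'q].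
  rewrite [in LHS]Eq nested_from_marked -Eq IHk mulr_sumr.
  apply: eq_bigr => c c_fam.
  rewrite (big_pred1 i) => [|j]; last first.
    rewrite /allowed {1}Eq mem_tnth Eq.
    by rewrite (inj_eq (increasing_tnth_inj l_incr)) eq_sym.
  rewrite /term [RHS](bigD1 i) /=; last by rewrite -Eq.
  congr (_ * _).
    rewrite word_update eqxx -Eq eqxx /=.
    (* The factor just read has not been differentiated: positions beyond
       [tnth l i] only act on later factors. *)
    suff -> : word c n.+1 i = [::] by [].
    rewrite /word (_ : [seq _ <- _ | _] = [::]) //.
    apply/eqP; rewrite -(negbK (_ == _)) -has_filter; apply/hasPn => t.
    rewrite mem_positions => lt_nt; apply/negP => /andP[/eqP Ec _].
    have /familyP/(_ t) := c_fam.
    rewrite /allowed_from lt_nt Ec unfold_in => /allowed_leq.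
    by rewrite -Eq leqNgt lt_nt.
  apply: eq_big => [j|j lt_nj]; last first.
    rewrite word_update; case: eqP => [Eij|//] /=.
    by rewrite -Eij -Eq ltnn in lt_nj.
  rewrite ltn_neqAle andbC -[n]/(val q) (inj_eq val_inj) Eq.
  by rewrite (inj_eq (increasing_tnth_inj l_incr)) eq_sym.
rewrite (@nested_from_unmarked [:: q]) => [|t]; last by rewrite inE => /eqP->.
rewrite /= IHk.
have D c : c \in family (allowed_from y n.+1) -> forall j : 'I_p,
    (n < tnth l j)%N ->
    has_partials (vfields V (word c n.+1 j) (f j (alpha (tnth l j)))).
  move=> c_fam j _ i z; apply: (@classC_derivable _ _ 1) => //.
  by apply: (classC_vfields V_C) => //; apply: (size_word_lt (k := q) _ c_fam).
rewrite vfield_sum => [|c c_fam]; last by apply: has_partials_prod; apply: D.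
apply: eq_bigr => c c_fam; rewrite vfield_prod; last exact: D.
have ne_q j : q != tnth l j by apply: contraNneq l'q => ->; apply: mem_tnth.
have ltE j : (n <= tnth l j)%N = (n < tnth l j)%N.
  by rewrite [RHS]ltn_neqAle -[n]/(val q) (inj_eq val_inj) ne_q.
apply: eq_big => [j|a _]; first by rewrite /allowed (negbTE l'q) ltE.
apply: eq_big => [j|j _]; first by rewrite ltE.
by rewrite word_update ne_q andbT eq_sym; case: eqP.
Qed.

End Expansion.

(** * Listing the positions factor by factor *)

Section Listings.
Variables r p : nat.
Variable l : p.+1.-tuple 'I_r.
Implicit Types (c : {ffun 'I_r -> 'I_p.+1}) (tau : p.+1.-tuple 'I_r).
Implicit Types (rho : 'S_r).

(** The order in which a listing runs through the positions. *)
Definition lexlt c (k q : 'I_r) : bool :=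
  (c k < c q)%N || (c k == c q) && (k < q)%N.

Lemma lexlt_irr c k : lexlt c k k = false.
Proof. by rewrite /lexlt !ltnn andbF. Qed.

Lemma lexlt_trans c : transitive (lexlt c).
Proof.
move=> q k t; rewrite /lexlt => /orP[lt_kq|/andP[/eqP-> lt_kq]]
  /orP[lt_qt|/andP[/eqP<- lt_qt]]; apply/orP.
- by left; apply: ltn_trans lt_kq lt_qt.
- by left.
- by left.
by right; rewrite eqxx (ltn_trans lt_kq lt_qt).
Qed.

Lemma lexlt_total c k q : k != q -> lexlt c k q || lexlt c q k.
Proof. by rewrite /lexlt -!(inj_eq val_inj) /=; do 2![case: ltngtP => //= _]. Qed.

Lemma lexlt_geF c k q : lexlt c k q -> lexlt c q k = false.
Proof. by move=> lt_kq; apply/negP => /(lexlt_trans lt_kq); rewrite lexlt_irr. Qed.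

Lemma rank_proof c k : (#|[set q | lexlt c q k]| < r)%N.
Proof.
rewrite -[X in (_ < X)%N]card_ord -cardsT; apply/proper_card/properP; split.
  exact: finset.subsetT.
by exists k; rewrite !inE ?lexlt_irr.
Qed.

(** Counting predecessors turns the listing order into a permutation; its inverse
    lists the positions. *)
Definition rank c k : 'I_r := Ordinal (rank_proof c k).

Lemma rank_lt c k q : (rank c k < rank c q)%N = lexlt c k q.
Proof.
have lt_rank a b : lexlt c a b -> (rank c a < rank c b)%N.
  move=> lt_ab; apply/proper_card/properP; split;
    last by exists a; rewrite !inE ?lexlt_irr.
  by apply/fintype.subsetP => t; rewrite !inE => /lexlt_trans; apply.
apply/idP/idP => [lt_kq|/lt_rank //]; have [Ekq|] := eqVneq k q.
  by rewrite Ekq ltnn in lt_kq.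
by case/(lexlt_total c)/orP => // /lt_rank; rewrite ltnNge ltnW.
Qed.

Lemma rank_inj c : injective (rank c).
Proof.
move=> k q Ekq; apply/eqP; apply/negPn/negP => /(lexlt_total c).
by rewrite -!rank_lt Ekq ltnn.
Qed.

Definition listing c : 'S_r := (perm (@rank_inj c))^-1%g.

Definition block_ends c : p.+1.-tuple 'I_r := [tuple of map (rank c) l].

(** The block of [tau] in which [rho] lists [k] is the first one whose end is not
    before the place of [k] in the listing. *)
Definition target tau rho : {ffun 'I_r -> 'I_p.+1} :=
  [ffun k => [arg min_(i < ord_max | ((rho^-1)%g k <= tnth tau i)%N) i]%N].

Lemma listingVE c k : ((listing c)^-1)%g k = rank c k.
Proof. by rewrite invgK permE. Qed.

Lemma listing_rank c k : listing c (rank c k) = k.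
Proof. by rewrite -listingVE permKV. Qed.

Lemma rank_listing c q : rank c (listing c q) = q.
Proof. by rewrite -listingVE permK. Qed.

Lemma tnth_block_ends c i : tnth (block_ends c) i = rank c (tnth l i).
Proof. exact: tnth_map. Qed.

Lemma XiP tau rho : reflect
  [/\ forall i j : 'I_p.+1, (i < j)%N -> (rho (tnth tau i) < rho (tnth tau j))%N,
      forall (i : 'I_p.+1) (a b : 'I_r), (pos tau i <= a)%N -> (a < b)%N ->
        (b <= tnth tau i)%N -> (rho a < rho b)%N
    & forall i, rho (tnth tau i) = tnth l i]
  (rho \in Xi l tau).
Proof.
rewrite inE; apply: (iffP and3P) => -[H1 H2 H3]; split.
- by move=> i j; have /forallP/(_ i)/forallP/(_ j)/implyP := H1.
- move=> i a b ge_a lt_ab le_b.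
  have /forallP/(_ i)/forallP/(_ a)/forallP/(_ b)/implyP := H2; apply.
  by rewrite posS !ltnS ge_a lt_ab.
- by move=> i; apply/eqP; have /forallP := H3.
- by apply/forallP => i; apply/forallP => j; apply/implyP; apply: H1.
- apply/forallP => i; apply/forallP => a; apply/forallP => b; apply/implyP.
  by rewrite posS !ltnS => /and3P[]; apply: H2.
by apply/forallP => i; apply/eqP.
Qed.

Lemma tnth_last tau : increasing_to_end tau -> (tnth tau ord_max).+1 = r.
Proof. by move=> incr_tau; rewrite -posS; exact: increasing_pos. Qed.

Lemma card_perm_lt rho (n : nat) : (n <= r)%N -> #|[set q | (rho q < n)%N]| = n.
Proof.
move=> le_nr; rewrite -(card_imset _ (@perm_inj _ rho)).
rewrite (_ : _ @: _ = [set i : 'I_r | (i < n)%N]); last first.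
  apply/setP => i; rewrite -{1}(permKV rho i) mem_imset ?inE ?permKV //.
  exact: perm_inj.
rewrite -sum1_card (eq_bigl (fun i : 'I_r => (i < n)%N)) => [|i];
  last by rewrite inE.
by rewrite -(big_ord_widen r (fun=> 1%N) le_nr) sum_nat_const card_ord muln1.
Qed.

Hypothesis l_incr : increasing_to_end l.

Lemma allowedP c : reflect
  ((forall k : 'I_r, (k <= tnth l (c k))%N) /\ (forall i, c (tnth l i) = i))
  (c \in family (allowed l)).
Proof.
have l_inj := increasing_tnth_inj l_incr.
apply: (iffP familyP) => [c_all|[c_leq c_l] k].
  split=> [k|i]; first by have:= c_all k; rewrite unfold_in; apply: allowed_leq.
  have:= c_all (tnth l i); rewrite unfold_in /allowed mem_tnth.
  by rewrite (inj_eq l_inj) => /eqP.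
rewrite unfold_in /allowed; case: ifP => // /tnthP[i ->].
by rewrite c_l.
Qed.

Section FromTarget.
Variable c : {ffun 'I_r -> 'I_p.+1}.
Hypothesis c_allowed : c \in family (allowed l).

(** Everything sent to [i] is at most [tnth l i], so [tnth l i] is listed last
    among the positions sent to [i]; hence the block ends recover [c]. *)
Lemma rank_leq_end k i : (rank c k <= rank c (tnth l i))%N = (c k <= i)%N.
Proof.
have [c_leq c_l] := allowedP _ c_allowed.
rewrite leqNgt rank_lt /lexlt c_l negb_or -leqNgt.
case: (i =P c k) => [->|_] /=; last by rewrite andbT.
by rewrite -leqNgt c_leq andbT.
Qed.

Lemma block_ends_increasing : increasing_to_end (block_ends c).
Proof.
have [c_leq c_l] := allowedP _ c_allowed.
apply: increasingI => [i j lt_ij|].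
  by rewrite !tnth_block_ends rank_lt /lexlt !c_l lt_ij.
rewrite (posS _ ord_max) tnth_block_ends; apply/eqP; rewrite eqn_leq ltn_ord.
(* [r.-1] is the rank of some position, whose target is at most [ord_max]. *)
have r_gt0 : (0 < r)%N := leq_ltn_trans (leq0n _) (ltn_ord (tnth l ord_max)).
have lt_r : (r.-1 < r)%N by rewrite prednK.
rewrite -{1}(prednK r_gt0) ltnS -[r.-1]/(val (Ordinal lt_r)).
by rewrite -(rank_listing c (Ordinal lt_r)) rank_leq_end leq_ord.
Qed.

Lemma pos_block_ends (i : 'I_p.+1) k :
  (pos (block_ends c) i <= rank c k)%N = (i <= c k)%N.
Proof.
rewrite pos_leq ?block_ends_increasing //; apply/forallP/idP => [lt_rk|le_i j].
  rewrite leqNgt; apply/negP => lt_ci; have:= lt_rk (c k).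
  by rewrite lt_ci tnth_block_ends ltnNge rank_leq_end leqnn.
apply/implyP => lt_ji; rewrite tnth_block_ends ltnNge rank_leq_end -ltnNge.
exact: leq_trans lt_ji le_i.
Qed.

Lemma listing_Xi : listing c \in Xi l (block_ends c).
Proof.
apply/XiP; split=> [i j lt_ij|i a b|i]; rewrite ?tnth_block_ends ?listing_rank //.
  exact: increasing_tnth.
rewrite -{1 2}(rank_listing c a) -{1 2}(rank_listing c b) pos_block_ends.
rewrite rank_lt rank_leq_end => ge_i /orP[lt_c|/andP[] //] le_i.
by have:= leq_ltn_trans ge_i (leq_trans lt_c le_i); rewrite ltnn.
Qed.

Lemma target_listing : target (block_ends c) (listing c) = c.
Proof.
apply/ffunP => k; rewrite ffunE listingVE.
case: arg_minnP => [|i].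
  by rewrite tnth_block_ends rank_leq_end leq_ord.
rewrite tnth_block_ends rank_leq_end => le_i /(_ (c k)).
rewrite tnth_block_ends rank_leq_end leqnn => /(_ isT) ge_i.
by apply/val_inj/eqP; rewrite eqn_leq le_i ge_i.
Qed.

End FromTarget.

Section FromListing.
Variables (tau : p.+1.-tuple 'I_r) (rho : 'S_r).
Hypothesis tau_incr : increasing_to_end tau.
Hypothesis rho_Xi : rho \in Xi l tau.

Lemma target_leq k (i : 'I_p.+1) :
  (target tau rho k <= i)%N = ((rho^-1)%g k <= tnth tau i)%N.
Proof.
rewrite ffunE; case: arg_minnP => [|j le_j min_j].
  by rewrite -ltnS (tnth_last tau_incr).
apply/idP/idP => [le_ji|/min_j //]; apply: leq_trans le_j _.
by rewrite increasing_tnth_leq.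
Qed.

Lemma pos_target k (i : 'I_p.+1) :
  (i <= target tau rho k)%N -> (pos tau i <= (rho^-1)%g k)%N.
Proof.
move=> le_i; rewrite pos_leq //; apply/forallP => j; apply/implyP => lt_ji.
by rewrite ltnNge -target_leq -ltnNge (leq_trans lt_ji).
Qed.

(** A listing that is increasing inside its blocks is increasing for the listing
    order of its targets, and a permutation with this property is unique. *)
Lemma lexlt_target k q :
  lexlt (target tau rho) k q = ((rho^-1)%g k < (rho^-1)%g q)%N.
Proof.
have [_ rho_incr _] := XiP _ _ rho_Xi.
have lexI a b : ((rho^-1)%g a < (rho^-1)%g b)%N -> lexlt (target tau rho) a b.
  move=> lt_ab; rewrite /lexlt.
  have: (target tau rho a <= target tau rho b)%N.
    by rewrite target_leq (leq_trans (ltnW lt_ab)) // -target_leq.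
  rewrite leq_eqVlt (inj_eq val_inj) => /orP[/eqP Eab|-> //].
  rewrite Eab eqxx ltnn /= -(permKV rho a) -(permKV rho b).
  apply: (rho_incr (target tau rho b)) => //; last by rewrite -target_leq.
  by apply: pos_target; rewrite Eab.
apply/idP/idP => [lt_kq|/lexI //]; rewrite ltnNge leq_eqVlt.
apply/negP => /orP[/eqP/val_inj/perm_inj Eqk|/lexI]; last by rewrite lexlt_geF.
by rewrite Eqk lexlt_irr in lt_kq.
Qed.

Lemma rank_target k : rank (target tau rho) k = (rho^-1)%g k.
Proof.
apply: val_inj; rewrite /= -[RHS](@card_perm_lt (rho^-1)%g);
  last exact: ltnW (ltn_ord _).
by apply: eq_card => q; rewrite !inE lexlt_target.
Qed.

Lemma listing_target : listing (target tau rho) = rho.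
Proof.
apply: invg_inj; apply/permP => k; rewrite listingVE; exact: rank_target.
Qed.

Lemma block_ends_target : block_ends (target tau rho) = tau.
Proof.
have [_ _ rho_tau] := XiP _ _ rho_Xi.
by apply: eq_from_tnth => i; rewrite tnth_block_ends rank_target -rho_tau permK.
Qed.

Lemma target_allowed : target tau rho \in family (allowed l).
Proof.
have [_ rho_incr rho_tau] := XiP _ _ rho_Xi.
apply/allowedP; split=> [k|i].
  set i := target _ _ _.
  have le_k : ((rho^-1)%g k <= tnth tau i)%N by rewrite -target_leq.
  rewrite -rho_tau -{1}(permKV rho k); move: le_k; rewrite leq_eqVlt.
  case/orP=> [/eqP/val_inj->//|lt_k]; apply: ltnW; apply: (rho_incr i) => //.
  exact: pos_target.
apply/val_inj/eqP; rewrite eqn_leq target_leq -rho_tau permK leqnn /=.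
rewrite -(increasing_tnth_leq _ _ tau_incr).
by rewrite -{1}(permK rho (tnth tau i)) -target_leq.
Qed.

End FromListing.

(** Both constructions being inverse to each other, this is a reindexing. *)
Lemma big_listing (S : nmodType) (G : p.+1.-tuple 'I_r -> 'S_r -> S) :
  \sum_(tau | increasing_to_end tau) \sum_(rho in Xi l tau) G tau rho =
  \sum_(c in family (allowed l)) G (block_ends c) (listing c).
Proof.
rewrite pair_big_dep /=.
rewrite (reindex_onto (fun c => (block_ends c, listing c))
                      (fun tr => target tr.1 tr.2)) /=.
  apply: eq_bigl => c; apply/idP/idP => [/andP[/andP[incr Xi_c] /eqP <-]|c_all].
    exact: target_allowed.
  by rewrite block_ends_increasing ?listing_Xi ?target_listing ?eqxx.
case=> tau rho /= /andP[incr Xi_rho].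
by rewrite block_ends_target ?listing_target.
Qed.

(** Both sides list, in increasing order, the positions sent to [i] other than
    [tnth l i] itself. *)
Lemma between_listing (m : nat) (alpha : 'I_r -> 'I_m) c (i : 'I_p.+1) :
    c \in family (allowed l) ->
  between (fun k => alpha (listing c k))
    (pos (block_ends c) i) (pos (block_ends c) i.+1) =
  word alpha l c 0 i.
Proof.
move=> c_all; have [c_leq c_l] := allowedP _ c_all.
have [_ rho_incr _] := XiP _ _ (listing_Xi c_all).
rewrite /between /word positions_from0 map_comp posS; congr map.
apply: ord_sorted_eq.
- rewrite sorted_map; set s := [seq _ <- _ | _].
  pose inside (q : 'I_r) :=
    (pos (block_ends c) i < q.+1 < (tnth (block_ends c) i).+1)%N.
  have: all inside s.
    by apply: filter_all.
  move=> /sub_in_sorted; apply; last exact: filter_enum_ord_sorted.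
  move=> a b; rewrite !unfold_in !ltnS => /andP[ge_a _] /andP[_ lt_b] lt_ab.
  by apply: rho_incr ge_a lt_ab (ltnW lt_b).
- exact: filter_enum_ord_sorted.
move=> k; rewrite -{1}(listing_rank c k) mem_map; last exact: perm_inj.
rewrite !mem_filter_enum !ltnS pos_block_ends // tnth_block_ends.
rewrite rank_lt /lexlt c_l -!(inj_eq val_inj) /=.
case: (ltngtP i (c k)) => //= Eik.
by rewrite ltn_neqAle (val_inj Eik) c_leq andbT.
Qed.

End Listings.

(** * The expansion formula *)

Theorem proposition2p11 (R : realType) (d m r p : nat)
    (alpha : 'I_r -> 'I_m) (l : p.-tuple 'I_r)
    (V : 'I_d -> 'I_m -> 'rV[R]_d -> R)
    (f : 'I_p -> 'I_m -> 'rV[R]_d -> R)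
    (p_gt0 : (0 < p)%N) (p_le_r : (p <= r)%N)
    (l_incr : increasing_to_end l)
    (V_C : forall (i : 'I_d) (j : 'I_m), classC (r - p) (V i j))
    (f_C : forall (i : 'I_p) (j : 'I_m), classC (r - p) (f i j))
    (x : 'rV[R]_d) :
  nested V f alpha l x =
  \sum_(tau : p.-tuple 'I_r | increasing_to_end tau)
    \sum_(rho in Xi l tau)
      \prod_(i < p)
        vfields V (between (fun k => alpha (rho k)) (pos tau i) (pos tau i.+1))
          (f i (alpha (rho (tnth tau i)))) x.
Proof.
case: p p_gt0 l p_le_r f l_incr V_C f_C => // p _ l _ f l_incr V_C f_C.
rewrite nested_positions // -positions_from0.
rewrite (expand_positions alpha l_incr V_C f_C ord0) //.
rewrite (@big_listing _ _ _ l_incr _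
           (fun tau rho => \prod_(i < p.+1) vfields V _ _ _)).
apply: eq_bigr => c c_all.
apply: eq_big => [i|i _]; first by rewrite leq0n.
by rewrite between_listing // tnth_block_ends listing_rank.
Qed.
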